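(* Let a $d$-dimensional Hegselmann–Krause system with social network $G=(V,E)$, $n=|V|$ agents, and confidence bound $\varepsilon>0$ be socially stable, i.e. regardless of which agents are updated, at every step the influence network equals the social network $G$. Let $\delta>0$. Then under uniform random asynchronous updates the expected convergence time to a $\delta$-stable state is $\operatorname{O}\big(n|E|^2\log(\varepsilon/\delta)\big)$.
   Context: A $d$-dimensional Hegselmann–Krause system consists of a finite undirected graph $G=(V,E)$ (social network), a confidence bound $\varepsilon>0$, and initial positions $x_v(0)\in\mathbb{R}^d$. In a state, $N_v=\{u:\{u,v\}\in E,\ \|x_u-x_v\|_2\le\varepsilon\}\cup\{v\}$ is the influencing neighborhood of $v$, and the influence network is $(V,E_I)$ with $E_I=\{\{u,v\}\in E:\|x_u-x_v\|_2\le\varepsilon\}$; the length of an edge $\{u,v\}$ is $\|x_u-x_v\|_2$. Uniform random asynchronous updates: at each step one agent $v$ is chosen uniformly at random and set to $x_v(t+1)=\frac{1}{|N_v(t)|}\sum_{u\in N_v(t)}x_u(t)$, others unchanged. A state is $\delta$-stable if every edge of the influence network has length at most $\delta$; the convergence time is the number of steps until a $\delta$-stable state is first reached.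
   Formalization: The bound is stated as O(n|E|²(1 + max(0, log(ε/δ)))), since the literal O(n|E|² log(ε/δ)) fails when δ is just below ε (one edge of length ε needs one step) and is negative for δ > ε. *)

(* Defs.v *)
From HB Require Import structures.
From mathcomp Require Import all_boot all_order all_algebra.
From mathcomp Require Import all_classical all_reals.
From mathcomp Require Import ereal sequences exp.
Set Implicit Arguments. Unset Strict Implicit. Unset Printing Implicit Defensive.
Import Order.TTheory GRing.Theory Num.Theory.
Local Open Scope ring_scope.

Section HK.
Variables (R : realType) (d : nat) (V : finType).
(* social network: a simple undirected graph given by a symmetric irreflexive relation *)
Variable e : rel V.
Variable eps : R.

Definition state := V -> 'rV[R]_d.

Definition dist (x : state) (u v : V) : R :=
  Num.sqrt (\sum_(i < d) (x u ord0 i - x v ord0 i) ^+ 2).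

Definition edges : {set {set V}} :=
  [set A : {set V} | [exists u, exists v, e u v && (A == [set u; v])]].
Definition nedges : nat := #|edges|.

Definition nbhd (x : state) (v : V) : {set V} :=
  [set u | (u == v) || (e u v && (dist x u v <= eps))].

Definition update (x : state) (v : V) : state :=
  fun w => if w == v then (#|nbhd x v|%:R)^-1 *: \sum_(u in nbhd x v) x u
           else x w.

Definition run (x0 : state) (s : seq V) : state := foldl update x0 s.

Definition delta_stable (delta : R) (x : state) : bool :=
  [forall u, forall v, (e u v && (dist x u v <= eps)) ==> (dist x u v <= delta)].

Definition socially_stable (x0 : state) : Prop :=
  forall (s : seq V) (u v : V), e u v -> dist (run x0 s) u v <= eps.

(* P(T > t) under uniform random asynchronous updates: the fraction of the
   #|V|^t equally likely choice sequences of length t along which none of the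
   states x(0), ..., x(t) is delta-stable *)
Definition tail_prob (delta : R) (x0 : state) (t : nat) : R :=
  #|[set s : t.-tuple V |
      [forall k : 'I_t.+1, ~~ delta_stable delta (run x0 (take k s))]]|%:R
  / (#|V| ^ t)%:R.

(* expected convergence time E[T] = sum_{t >= 0} P(T > t), in extended reals *)
Definition expected_time (delta : R) (x0 : state) : \bar R :=
  (\sum_(0 <= t <oo) (tail_prob delta x0 t)%:E)%E.
End HK.

(* Main.v *)
(** Let S_v be the sum of x_u - x_v over the neighbours u of v, D_v the degree
    of v, P = 2|E| the number of arcs and F the sum of |x_u - x_v|^2 over all
    arcs.  Summation by parts shows that updating v lowers F by at least
    2 |S_v|^2 / (D_v + 1).  In each coordinate, summing S_v over a level set
    leaves only a cut, so every edge length is at most the sum of |S_v| over the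
    nonisolated v, and by AM-GM its square is at most
    2 P sum_v |S_v|^2 / (D_v + 1).  Taking the edge longer than delta, or
    averaging over all edges, F drops in expectation by at least
    max(delta^2, F / P) / (n P) in a state that is not delta-stable.  The first
    bound is what removes a factor log |E|: below F = P delta^2 the drift is
    treated as additive.  Hence n P^2 G(F / (P delta^2)) drops by at least 1 in
    expectation, where G' (s) = 1 / max(1, s) and G is concave, so its initial
    value bounds the expected time. *)
Require Import Defs.
From HB Require Import structures.
From mathcomp Require Import all_boot all_order all_algebra.
From mathcomp Require Import all_classical all_reals.
From mathcomp Require Import ereal sequences exp.
From mathcomp Require Import normedtype ring lra.
Import Order.TTheory GRing.Theory Num.Theory.
Local Open Scope ring_scope.
Set Implicit Arguments.
Unset Strict Implicit.
Unset Printing Implicit Defensive.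

(** * Scalar Dirichlet energy of a graph: its decrease under averaging, and edge length against
    dissipation *)

Section GraphEnergy.
Variables (R : realFieldType) (V : finType) (e : rel V).
Hypothesis e_sym : symmetric e.

Definition deg (v : V) : R := \sum_(u | e v u) 1.
Definition pull (f : V -> R) (v : V) : R := \sum_(u | e v u) (f u - f v).
Definition energy (f : V -> R) : R := \sum_a \sum_(b | e a b) (f a - f b) ^+ 2.
Definition arcs : R := \sum_a deg a.
Definition dissipation (f : V -> R) : R := \sum_v pull f v ^+ 2 / (deg v + 1).

Lemma deg_ge0 v : 0 <= deg v.
Proof. by apply: sumr_ge0. Qed.

Lemma deg1_gt0 v : 0 < deg v + 1.
Proof. by rewrite ltr_wpDl ?deg_ge0. Qed.

(** A discrete Green identity: reversing every arc, by symmetry of [e], shows that the two halves of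
    the product have the same sum. It is used with [g] a multiple of the indicator of a vertex, or
    the indicator of a level set. *)
Lemma summation_by_parts (f g : V -> R) :
  \sum_a \sum_(b | e a b) (f a - f b) * (g a - g b) =
  - (2 * \sum_a g a * pull f a).
Proof.
have half : \sum_a \sum_(b | e a b) (f a - f b) * g a = - \sum_a g a * pull f a.
  rewrite -sumrN; apply: eq_bigr => a _.
  rewrite /pull mulr_sumr -sumrN; apply: eq_bigr => b _; ring.
have -> : \sum_a \sum_(b | e a b) (f a - f b) * (g a - g b) =
    \sum_a \sum_(b | e a b) (f a - f b) * g a +
    \sum_a \sum_(b | e a b) (f b - f a) * g b.
  rewrite -big_split; apply: eq_bigr => a _; rewrite -big_split.
  apply: eq_bigr => b _ /=; ring.
rewrite [X in _ + X](exchange_big_dep xpredT) //=.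
under [X in _ + X]eq_bigr => b _ do under eq_bigl => a do rewrite e_sym.
by rewrite half mulr_natl mulr2n opprD.
Qed.

Hypothesis e_irr : irreflexive e.

(** With [c] the displacement and D the degree of [v], the cross term contributes -4 c^2 (D + 1) and
    the quadratic term 2 c^2 D, together at most -2 c^2 (D + 1). *)
Lemma energy_update (f f' : V -> R) (v : V) :
  (forall w, f' w = f w + (w == v)%:R * (pull f v / (deg v + 1))) ->
  energy f' <= energy f - 2 * (pull f v ^+ 2 / (deg v + 1)).
Proof.
set c := pull f v / (deg v + 1) => f'E.
pose g w : R := (w == v)%:R * c.
have pick (h : V -> R) : \sum_a g a * h a = c * h v.
  rewrite (bigD1 v) //= /g eqxx mul1r big1 ?addr0 // => a /negPf ->.
  by rewrite !mul0r.
have pull_g : pull g v = - (c * deg v).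
  rewrite /pull /deg mulr_sumr -sumrN; apply: eq_bigr => u evu.
  rewrite /g eqxx; case: eqVneq evu => [->|_ _]; first by rewrite e_irr.
  by rewrite mul0r mul1r mulr1 sub0r.
have -> : energy f' = energy f + 2 * (\sum_a \sum_(b | e a b)
    (f a - f b) * (g a - g b)) + \sum_a \sum_(b | e a b) (g a - g b) * (g a - g b).
  rewrite mulr_sumr -!big_split; apply: eq_bigr => a _ /=.
  rewrite mulr_sumr -!big_split; apply: eq_bigr => b _ /=.
  rewrite !f'E /g; ring.
rewrite !summation_by_parts !pick pull_g.
have d1 := deg1_gt0 v.
have pullE : pull f v = c * (deg v + 1) by rewrite /c divfK ?gt_eqF.
have -> : pull f v ^+ 2 / (deg v + 1) = c ^+ 2 * (deg v + 1).
  by rewrite pullE; field; rewrite gt_eqF.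
rewrite pullE; have := sqr_ge0 c; have := deg_ge0 v; nra.
Qed.

(* Summing the pulls over the level set [f <= f a] leaves only the edges of the
   cut it defines, all of the same sign, among them (a, b). *)
Lemma cut_pull (f : V -> R) (a b : V) : e a b -> f a < f b ->
  f b - f a <= \sum_v (f v <= f a)%R%:R * pull f v.
Proof.
move=> eab fab; pose g v : R := (f v <= f a)%R%:R.
have /eqP := summation_by_parts f g.
rewrite -eqr_oppLR -sumrN => /eqP sbp.
suff : 2 * (f b - f a) <= 2 * \sum_v g v * pull f v by rewrite ler_pM2l.
rewrite -sbp.
have ge0 u v : 0 <= - ((f u - f v) * (g u - g v)).
  rewrite /g; case: (leP (f u) (f a)) => Hu; case: (leP (f v) (f a)) => Hv;
    rewrite ?(mulr1n, mulr0n); nra.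
have sge0 u : 0 <= - \sum_(v | e u v) (f u - f v) * (g u - g v).
  by rewrite -sumrN sumr_ge0.
have term u v : e u v ->
    - ((f u - f v) * (g u - g v)) <=
    - \sum_(v | e u v) (f u - f v) * (g u - g v).
  by move=> euv; rewrite -sumrN (bigD1 v) //= lerDl sumr_ge0.
have nab : b != a by apply: contraTneq fab => ->; rewrite ltxx.
(* Both orientations of the edge are kept, which accounts for the factor 2. *)
rewrite (bigD1 a) //= [X in _ <= _ + X](bigD1 b) //= addrA.
apply: (@le_trans _ _ (- ((f a - f b) * (g a - g b)) - ((f b - f a) * (g b - g a)))).
  by rewrite /g lexx (lt_geF fab) mulr1n mulr0n; lra.
by rewrite -[leLHS]addr0 !lerD ?term ?sumr_ge0 // e_sym.
Qed.

Lemma edge_le_dissipation (f : V -> R) (a b : V) : e a b ->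
  (f a - f b) ^+ 2 <= 2 * arcs * dissipation f.
Proof.
wlog fab : a b / f a < f b.
  move=> H eab; case: (ltgtP (f a) (f b)) => [/H|/H|->]; first exact.
    by rewrite -sqrrN opprB; apply; rewrite e_sym.
  rewrite subrr expr0n mulr_ge0 ?mulr_ge0 ?sumr_ge0 // => v _.
    exact: deg_ge0.
  by rewrite divr_ge0 ?sqr_ge0 // ltW ?deg1_gt0.
move=> eab; have := cut_pull eab fab.
set L := f b - f a => cut; have L0 : 0 < L by rewrite subr_gt0.
have deg_ge1 u v : e u v -> 1 <= deg u.
  by move=> euv; rewrite /deg (bigD1 v) //= lerDl sumr_ge0.
have arcs_gt0 : 0 < arcs.
  rewrite /arcs (bigD1 a) //= ltr_wpDr ?sumr_ge0 // => [v _|].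
    exact: deg_ge0.
  exact: lt_le_trans ltr01 (deg_ge1 _ _ eab).
have pointwise v : 2 * L * ((f v <= f a)%R%:R * pull f v) <=
    L ^+ 2 / arcs * deg v + 2 * arcs * (pull f v ^+ 2 / (deg v + 1)).
  set g := (f v <= f a)%R%:R; set D := deg v; set S := pull f v.
  (* Isolated vertices have zero pull; at the others D >= 1, hence (D + 1) / 2 <= D. *)
  have [u evu|no] := pickP (e v); last first.
    have -> : S = 0 by rewrite /S /pull big_pred0.
    rewrite !mulr0 expr0n mul0r mulr0 addr0 mulr_ge0 ?deg_ge0 //.
    by rewrite divr_ge0 ?sqr_ge0 ?ltW.
  have D1 : 1 <= D := deg_ge1 _ _ evu.
  apply: (@le_trans _ _ (L ^+ 2 / arcs * ((D + 1) / 2)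
      + 2 * arcs * (S ^+ 2 / (D + 1)))); last first.
    rewrite lerD2r ler_wpM2l ?divr_ge0 ?sqr_ge0 ?(ltW arcs_gt0) //; lra.
  (* AM-GM weight: summed over the nonisolated vertices, [L ^+ 2 * t] is at most [L ^+ 2], half of
     the final left-hand side. *)
  set t := (D + 1) / (2 * arcs).
  have t0 : 0 < t by rewrite divr_gt0 ?mulr_gt0 //; lra.
  have -> : L ^+ 2 / arcs * ((D + 1) / 2) = L ^+ 2 * t.
    by rewrite /t; field; rewrite gt_eqF.
  have -> : 2 * arcs * (S ^+ 2 / (D + 1)) = S ^+ 2 / t.
    by rewrite /t; field; rewrite !gt_eqF //; lra.
  have gS : 2 * L * (g * S) <= L ^+ 2 * t + (g * S) ^+ 2 / t.
    rewrite -subr_ge0.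
    have -> : L ^+ 2 * t + (g * S) ^+ 2 / t - 2 * L * (g * S)
        = (L * t - g * S) ^+ 2 / t by field; rewrite gt_eqF.
    by rewrite divr_ge0 ?sqr_ge0 ?ltW.
  apply: le_trans gS _; rewrite lerD2l ler_wpM2r ?invr_ge0 ?(ltW t0) //.
  rewrite /g; case: (f v <= f a); first by rewrite mulr1n mul1r.
  by rewrite mulr0n mul0r expr0n sqr_ge0.
have : 2 * L * L <= L ^+ 2 / arcs * arcs + 2 * arcs * dissipation f.
  apply: (@le_trans _ _ (\sum_v 2 * L * ((f v <= f a)%R%:R * pull f v))).
    by rewrite -mulr_sumr ler_wpM2l // mulr_ge0 // ltW.
  apply: le_trans (ler_sum _ (fun v _ => pointwise v)) _.
  by rewrite big_split -!mulr_sumr.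
rewrite divfK ?gt_eqF // -(opprB (f b)) sqrrN -/L; lra.
Qed.

End GraphEnergy.

(** * A concave function, linear up to 1 and logarithmic beyond *)

Section LogGrowth.
Variable R : realType.
Implicit Types s t r : R.

(* The concave C^1 function with derivative 1 / max(1, s) vanishing at 0. *)
Definition log_growth s : R := if s <= 1 then s else 1 + ln s.

Lemma ln_le_sub1 s : 0 < s -> ln s <= s - 1.
Proof.
move=> s0; have := @le_ln1Dx R (s - 1); rewrite (addrC 1) subrK; apply; lra.
Qed.

Lemma log_growth_ge0 s : 0 <= s -> 0 <= log_growth s.
Proof.
rewrite /log_growth; case: (leP s 1) => // s1 _.
by rewrite addr_ge0 // ln_ge0 // ltW.
Qed.

(** Concavity: the graph lies below its tangent at [s]. Where a logarithm is involved, ln z <= z - 1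
    is applied at z = t, 1/s or t/s. *)
Lemma log_growth_tangent s t : 0 <= s -> 0 <= t ->
  log_growth t <= log_growth s + (t - s) / Num.max 1 s.
Proof.
move=> s0 t0; rewrite /log_growth; case: (leP s 1) => s1.
  rewrite divr1 [s + _]addrC subrK; case: (leP t 1) => // t1.
  have := @ln_le_sub1 t; rewrite -lerBrDl; apply; lra.
have sp : 0 < s by lra.
have -> : (t - s) / s = t / s - 1 by field; rewrite gt_eqF.
case: (leP t 1) => t1.
  have := @ln_le_sub1 s^-1; rewrite invr_gt0 sp lnV ?posrE // => /(_ isT) lns.
  have : t * (1 - s^-1) <= 1 - s^-1.
    by rewrite ler_piMl // subr_ge0 invf_le1 // ltW.
  lra.
have tp : 0 < t by lra.
have := @ln_le_sub1 (t / s); rewrite divr_gt0 // ln_div ?posrE // => /(_ isT).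
lra.
Qed.

Lemma log_growth_le_sqr s r : 0 < r -> s <= r ^+ 2 ->
  log_growth s <= 1 + 2 * Num.max 0 (ln r).
Proof.
move=> r0 sr; rewrite /log_growth.
have m0 : 0 <= Num.max 0 (ln r) by rewrite le_max lexx.
case: (leP s 1) => s1; first lra.
rewrite lerD2l; apply: (@le_trans _ _ (ln (r ^+ 2))).
  by rewrite ler_ln ?posrE ?exprn_gt0 //; lra.
by rewrite lnXn // -[leLHS]mulr_natl ler_wpM2l // le_max lexx orbT.
Qed.

End LogGrowth.

(** Counting form of conditioning on the first agent chosen. *)
Lemma card_tuple_cons (V : finType) (t : nat) (Q : pred (seq V)) :
  #|[set s : t.+1.-tuple V | Q s]| =
  (\sum_(v : V) #|[set s : t.-tuple V | Q (v :: s)]|)%N.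
Proof.
rewrite -sum1_card; under [RHS]eq_bigr => v _ do rewrite -sum1_card.
rewrite pair_big_dep /=.
pose h (p : V * t.-tuple V) : t.+1.-tuple V := [tuple of p.1 :: p.2].
rewrite (reindex h) /=; first by apply: eq_bigl => -[v s]; rewrite !inE.
exists (fun s => (thead s, [tuple of behead s])) => [[v s] _|s _] /=.
  by congr pair; apply: val_inj.
by rewrite /h /= -tuple_eta.
Qed.

(** * Energy and dissipation of a state, summed over coordinates *)

Section HegselmannKrause.
Variables (R : realType) (d : nat) (V : finType) (e : rel V).
Hypotheses (e_sym : symmetric e) (e_irr : irreflexive e).
Variables eps delta : R.
Hypothesis delta_gt0 : 0 < delta.
Implicit Types (x : state R d V) (u v w : V).

Local Notation n := (#|V|%:R : R).
Local Notation P := (arcs R e).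

Definition coord x (i : 'I_d) : V -> R := fun v => x v ord0 i.
Definition total_energy x : R := \sum_i energy e (coord x i).
Definition total_dissipation x : R := \sum_i dissipation e (coord x i).

Lemma dist_sqr x u v : dist x u v ^+ 2 = \sum_i (coord x i u - coord x i v) ^+ 2.
Proof. by rewrite sqr_sqrtr // sumr_ge0 // => i _; apply: sqr_ge0. Qed.

Lemma total_energyE x : total_energy x = \sum_a \sum_(b | e a b) dist x a b ^+ 2.
Proof.
rewrite /total_energy /energy exchange_big /=; apply: eq_bigr => a _.
by rewrite exchange_big /=; apply: eq_bigr => b _; rewrite dist_sqr.
Qed.

Lemma total_energy_ge0 x : 0 <= total_energy x.
Proof.
by rewrite total_energyE; do 2!apply: sumr_ge0 => ? _; apply: sqr_ge0.
Qed.

Lemma sum_arcs (c : R) : \sum_a \sum_(b | e a b) c = P * c.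
Proof.
rewrite /arcs mulr_suml; apply: eq_bigr => a _.
by rewrite /deg mulr_suml; apply: eq_bigr => b _; rewrite mul1r.
Qed.

Lemma arcs_ge0 : 0 <= P.
Proof. by apply: sumr_ge0 => v _; apply: deg_ge0. Qed.

Lemma dist_le_dissipation x a b : e a b ->
  dist x a b ^+ 2 <= 2 * P * total_dissipation x.
Proof.
move=> eab; rewrite dist_sqr mulr_sumr; apply: ler_sum => i _.
exact: edge_le_dissipation.
Qed.

Lemma energy_le_dissipation x :
  total_energy x <= P * (2 * P * total_dissipation x).
Proof.
rewrite total_energyE -sum_arcs.
by do 2!apply: ler_sum => ? *; apply: dist_le_dissipation.
Qed.

(** * Effect of one update in a socially stable system *)

Lemma socially_stable_update x v :
  socially_stable e eps x -> socially_stable e eps (update e eps x v).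
Proof. by move=> st s; apply: (st (v :: s)). Qed.

(** Social stability, applied to the empty run, makes the confidence test vacuous: the neighbourhood
    is the closed neighbourhood in the graph. *)
Lemma sum_nbhd x v (F : V -> R) : socially_stable e eps x ->
  \sum_(u in nbhd e eps x v) F u = F v + \sum_(u | e v u) F u.
Proof.
move=> st; rewrite (bigD1 v) ?inE ?eqxx //=; congr (_ + _).
apply: eq_bigl => u; rewrite !inE; case: eqVneq => [->|_] /=.
  by rewrite e_irr.
rewrite andbT e_sym; apply/idP/idP => [/andP[] //|evu].
by rewrite evu; apply: (st [::]); rewrite e_sym.
Qed.

Lemma coord_update x v i w : socially_stable e eps x ->
  coord (update e eps x v) i w = coord x i w +
    (w == v)%:R * (pull e (coord x i) v / (deg R e v + 1)).
Proof.
move=> st; rewrite /coord /update; case: eqVneq => [->|_]; last first.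
  by rewrite mul0r addr0.
have d1 : deg R e v + 1 != 0 by rewrite gt_eqF ?deg1_gt0.
have -> : #|nbhd e eps x v|%:R = deg R e v + 1 :> R.
  by rewrite -sum1_card natr_sum sum_nbhd // addrC.
rewrite mxE summxE sum_nbhd // mul1r /pull sumrB.
have -> : \sum_(u | e v u) x v ord0 i = deg R e v * x v ord0 i.
  by rewrite /deg mulr_suml; apply: eq_bigr => u _; rewrite mul1r.
by field.
Qed.

(** The expected one-step drift multiplied by n: summing over the updated agent avoids a
    division. *)
Lemma total_energy_drift x : socially_stable e eps x ->
  \sum_v total_energy (update e eps x v) <=
  n * total_energy x - 2 * total_dissipation x.
Proof.
move=> st.
have -> : n * total_energy x - 2 * total_dissipation x =
    \sum_v \sum_i (energy e (coord x i)
       - 2 * (pull e (coord x i) v ^+ 2 / (deg R e v + 1))).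
  rewrite exchange_big /= /total_energy /total_dissipation !mulr_sumr -sumrB.
  apply: eq_bigr => i _; rewrite sumrB sumr_const -mulr_sumr.
  by rewrite -[RHS]/(_ *+ #|V| - _) mulr_natl.
apply: ler_sum => v _; apply: ler_sum => i _.
by apply: energy_update => // w; apply: coord_update.
Qed.

(** * The potential and its drift *)

Definition potential x : R :=
  n * P ^+ 2 * log_growth (total_energy x / (P * delta ^+ 2)).

Lemma scaled_energy_ge0 x : 0 <= total_energy x / (P * delta ^+ 2).
Proof.
by rewrite divr_ge0 ?total_energy_ge0 // mulr_ge0 ?arcs_ge0 // sqr_ge0.
Qed.

Lemma potential_ge0 x : 0 <= potential x.
Proof.
by rewrite !mulr_ge0 ?ler0n ?exprn_ge0 ?arcs_ge0 // log_growth_ge0 ?scaled_energy_ge0.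
Qed.

Lemma potential_drift x : socially_stable e eps x ->
  ~~ delta_stable e eps delta x ->
  \sum_v potential (update e eps x v) <= n * (potential x - 1).
Proof.
move=> st /forallPn[a /forallPn[b]]; rewrite negb_imply => /andP[/andP[eab _]].
rewrite -ltNge => dab.
have n0 : 0 <= n by apply: ler0n.
have P0 : 0 < P.
  have a1 : 1 <= deg R e a by rewrite /deg (bigD1 b) //= lerDl sumr_ge0.
  rewrite /arcs (bigD1 a) //= ltr_wpDr ?(lt_le_trans ltr01) // sumr_ge0 // => v _.
  exact: deg_ge0.
have PS0 : 0 < P ^+ 2 by rewrite exprn_gt0.
have D0 : 0 < delta ^+ 2 by rewrite exprn_gt0.
set T := total_dissipation x; set q := P * delta ^+ 2.
have q0 : 0 < q by rewrite mulr_gt0.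
set s := total_energy x / q.
pose s_ v := total_energy (update e eps x v) / q.
have s0 : 0 <= s by apply: scaled_energy_ge0.
have max0 : 0 < Num.max 1 s by rewrite lt_max ltr01.
have driftT : \sum_v (s_ v - s) <= - (2 * T / q).
  rewrite sumrB -mulr_suml sumr_const -[_ *+ _]mulr_natl /s mulrA -mulrBl -[leRHS]mulNr.
  rewrite ler_pM2r ?invr_gt0 //.
  have := total_energy_drift st; rewrite -/T; lra.
(* The edge longer than [delta] gives the bound by 1, averaging over all arcs the bound by [s]. *)
have drift : Num.max 1 s <= P ^+ 2 * (2 * T / q).
  have -> : P ^+ 2 * (2 * T / q) = 2 * P * T / delta ^+ 2.
    by rewrite /q; field; rewrite !gt_eqF.
  rewrite ge_max ler_pdivlMr // mul1r; apply/andP; split.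
    apply: le_trans (dist_le_dissipation x eab).
    by rewrite ler_sqr ?nnegrE ?sqrtr_ge0 ?ltW.
  rewrite /s ler_pdivrMr //.
  have -> : 2 * P * T / delta ^+ 2 * q = P * (2 * P * T).
    by rewrite /q; field; rewrite !gt_eqF.
  exact: energy_le_dissipation.
(* The tangent slope [1 / Num.max 1 s] cancels the size of the drift, leaving a decrease independent
   of [s]. *)
have key : \sum_v log_growth (s_ v) <= n * log_growth s - (P ^+ 2)^-1.
  apply: (@le_trans _ _ (\sum_v (log_growth s + (s_ v - s) / Num.max 1 s))).
    by apply: ler_sum => v _; apply: log_growth_tangent => //; apply: scaled_energy_ge0.
  rewrite big_split /= sumr_const -[_ *+ _]mulr_natl lerD2l -mulr_suml.
  rewrite ler_pdivrMr // mulNr.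
  apply: le_trans driftT _; rewrite lerN2.
  by rewrite mulrC ler_pdivrMr // mulrC.
rewrite /potential -mulr_sumr.
have -> : n * (n * P ^+ 2 * log_growth s - 1) =
    n * P ^+ 2 * (n * log_growth s - (P ^+ 2)^-1) by field; rewrite gt_eqF.
by rewrite ler_wpM2l // mulr_ge0 // ltW.
Qed.

(** * Tail probabilities and expected convergence time *)

Lemma tail_prob0 x :
  tail_prob e eps delta x 0 = (~~ delta_stable e eps delta x)%:R.
Proof.
rewrite /tail_prob expn0 divr1; congr (_%:R).
case st : (delta_stable e eps delta x) => /=.
  apply: eq_card0 => s; rewrite !inE; apply/negbTE/forallPn; exists ord0.
  by rewrite take0 /= st.
rewrite (@eq_card _ _ predT) ?card_tuple ?expn0 // => s; rewrite !inE.
by apply/forallP => k; rewrite [s]tuple0 /= st.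
Qed.

(** First-step analysis: index 0 tests the initial state, the later indices test the run from the
    updated state. *)
Lemma tail_probS x t :
  tail_prob e eps delta x t.+1 = (~~ delta_stable e eps delta x)%:R *
    ((\sum_v tail_prob e eps delta (update e eps x v) t) / n).
Proof.
rewrite /tail_prob (card_tuple_cons _ (fun s => [forall k : 'I_t.+2,
  ~~ delta_stable e eps delta (run e eps x (take k s))])).
rewrite -mulr_suml -natr_sum expnS natrM invfM.
rewrite [_^-1 / _]mulrC !mulrA; congr (_ / _ / _).
rewrite -natrM big_distrr /=; congr (_%:R); apply: eq_bigr => v _.
case st : (delta_stable e eps delta x) => /=.
  rewrite mul0n; apply: eq_card0 => s; rewrite !inE.
  by apply/negbTE/forallPn; exists ord0; rewrite /= st.
rewrite mul1n; apply: eq_card => s; rewrite !inE.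
apply/forallP/forallP => [all k | all k].
  by have := all (lift ord0 k).
by case: (unliftP ord0 k) => [j|] ->; rewrite /= ?st //; apply: all.
Qed.

(** Drift argument by induction on the horizon, for all initial states at once: an unstable state
    pays 1 now, and the rest costs at most the mean potential after one update. *)
Lemma sum_tail_prob_le x N : socially_stable e eps x ->
  \sum_(0 <= t < N) tail_prob e eps delta x t <= potential x.
Proof.
elim: N x => [|N IHN] x st; first by rewrite big_nil potential_ge0.
rewrite big_nat_recl //= tail_prob0.
under eq_bigr => t _ do rewrite tail_probS.
rewrite -mulr_sumr -mulr_suml exchange_big /=.
case: (boolP (delta_stable e eps delta x)) => [_|unst] /=.
  by rewrite mul0r addr0 potential_ge0.
(* An unstable state has an edge, so there is an agent and division by n is legitimate. *)
have n0 : 0 < n.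
  by move/forallPn: unst => [a _]; rewrite ltr0n; apply/card_gt0P; exists a.
rewrite mul1r -lerBrDl ler_pdivrMr // mulrC.
apply: le_trans (potential_drift st unst); apply: ler_sum => v _.
by apply: IHN; apply: socially_stable_update.
Qed.

Lemma tail_prob_ge0 x t : 0 <= tail_prob e eps delta x t.
Proof. by rewrite divr_ge0. Qed.

Lemma expected_time_le_potential x : socially_stable e eps x ->
  (expected_time e eps delta x <= (potential x)%:E)%E.
Proof.
move=> st; apply: lime_le.
  by apply: is_cvg_nneseries => t _ _; rewrite lee_fin tail_prob_ge0.
by apply: nearW => N; rewrite sumEFin lee_fin sum_tail_prob_le.
Qed.

(** Forgetting the orientation maps arcs to edges with fibres of at most two elements. *)
Lemma arcs_le : P <= 2 * (nedges e)%:R.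
Proof.
have -> : P = #|[set p : V * V | e p.1 p.2]|%:R.
  rewrite /arcs /deg (pair_big_dep xpredT e (fun _ _ => 1)) /=.
  by rewrite -sum1_card natr_sum; apply: eq_bigl => p; rewrite inE.
rewrite -natrM ler_nat -sum1_card.
rewrite (partition_big (fun p : V * V => [set p.1; p.2]) (mem (edges e))) /=; last first.
  move=> [u v]; rewrite !inE /= => euv.
  by apply/existsP; exists u; apply/existsP; exists v; rewrite euv eqxx.
rewrite mulnC /nedges -sum_nat_const; apply: leq_sum => A.
rewrite inE => /existsP[u /existsP[v /andP[_ /eqP ->]]].
rewrite sum1_card; apply: (@leq_trans #|[set (u, v); (v, u)]|); last first.
  by rewrite cards2 ltnS leq_b1.
apply: subset_leq_card; apply/fintype.subsetP => -[a b]; rewrite !inE /= => /andP[eab /eqP AE].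
have := set22 a b; have := set21 a b; rewrite AE !inE.
by move=> /orP[]/eqP aE /orP[]/eqP bE; move: eab;
  rewrite inE aE bE /= ?e_irr // !xpair_eqE !eqxx ?orbT.
Qed.

End HegselmannKrause.

(** * The explicit bound in agents, edges and the logarithm *)

Theorem theorem4 :
  exists C : nat, forall (R : realType) (d : nat) (V : finType) (e : rel V),
    symmetric e -> irreflexive e ->
    forall (eps delta : R) (x0 : state R d V),
    0 < eps -> 0 < delta ->
    socially_stable e eps x0 ->
    (expected_time e eps delta x0 <=
      ((C%:R * #|V|%:R * (nedges e)%:R ^+ 2
        * (1 + Num.max 0 (ln (eps / delta)))) : R)%:E)%E.
Proof.
(* The constant is 4 * 2, from [P ^+ 2 <= 4 * m ^+ 2] and [1 + 2 * l <= 2 * (1 + l)]. *)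
exists 8%N => R d V e e_sym e_irr eps delta x eps_gt0 delta_gt0 st.
apply: le_trans (expected_time_le_potential e_sym e_irr delta_gt0 st) _.
rewrite lee_fin /potential; set P := arcs R e; set n := #|V|%:R.
set m := (nedges e)%:R; set l := Num.max _ _.
have P0 : 0 <= P := arcs_ge0 _ _.
have l0 : 0 <= l by rewrite le_max lexx.
have n0 : 0 <= n by apply: ler0n.
have Pm : P <= 2 * m := arcs_le R e_irr.
have energy_le : total_energy e x <= P * eps ^+ 2.
  rewrite total_energyE -sum_arcs; apply: ler_sum => a _; apply: ler_sum => b eab.
  by rewrite ler_sqr ?nnegrE ?sqrtr_ge0 ?(ltW eps_gt0) //; apply: (st [::]).
have growth : log_growth (total_energy e x / (P * delta ^+ 2)) <= 1 + 2 * l.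
  apply: log_growth_le_sqr; first by rewrite divr_gt0.
  (* Without arcs the scaled energy is a quotient by zero, which is 0 by convention. *)
  case: (eqVneq P 0) => [->|Pn0].
    by rewrite mul0r invr0 mulr0 sqr_ge0.
  have Pp : 0 < P by rewrite lt_def Pn0.
  rewrite ler_pdivrMr ?mulr_gt0 ?exprn_gt0 //.
  have -> // : (eps / delta) ^+ 2 * (P * delta ^+ 2) = P * eps ^+ 2.
  by field; rewrite gt_eqF.
have sq : P ^+ 2 <= 4 * m ^+ 2 by nra.
apply: (@le_trans _ _ (n * (4 * m ^+ 2) * (2 * (1 + l)))); last first.
  by rewrite le_eqVlt; apply/orP; left; apply/eqP; ring.
apply: ler_pM; rewrite ?mulr_ge0 ?sqr_ge0 ?log_growth_ge0 //.
- by rewrite divr_ge0 ?total_energy_ge0 // mulr_ge0 ?sqr_ge0.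
- by rewrite ler_wpM2l.
by apply: le_trans growth _; lra.
Qed.
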